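(* For any $\mathbb B\subseteq\mathbb R^+\setminus\{0\}$ such that $\mathrm{card}(\mathbb B)\ge2$, for any $\beta_1,\beta_2\in\mathbb B$ with $\beta_1\ne\beta_2$, any $L>0$, $0<A<M$, and $q\ge 1$, $$\liminf_{n\to\infty}\ \inf_{\tilde f}\Big[\varphi_n^{-q}(\beta_1)\,R_{n,q}\big(\tilde f,\mathbb H_d(\beta_1,L,M,A)\big)+\varphi_n^{-q}(\beta_2)\,R_{n,q}\big(\tilde f,\mathbb H_d(\beta_2,L,M,A)\big)\Big]=+\infty,$$ where the infimum is taken over all possible estimators and $\varphi_n(\beta)=n^{-\frac{\beta}{\beta+d}}$.
   Context: Model. Let $d\ge1$. For $n\in\mathbb N^*$ (with $n^{1/d}$ an integer; limits $n\to\infty$ are along such $n$), the deterministic design points $X_1,\dots,X_n$ are the points of the grid $\{1/n^{1/d},2/n^{1/d},\dots,1\}^d\subset[0,1]^d$. One observes $Y^{(n)}=(X_i,Y_i)_{i=1,\dots,n}$ with $Y_i=f(X_i)\,U_i$, where $U_1,\dots,U_n$ are independent and uniformly distributed on $[0,1]$ and $f:[0,1]^d\to\mathbb R$ is unknown. $\mathbb E_f$ denotes expectation under the law of $Y^{(n)}$. The goal is to estimate $f$ at a given point $y\in[0,1]^d$. An estimator is a measurable function of $Y^{(n)}$. Hölder class. For $p\in\mathbb N^d$ put $|p|=p_1+\dots+p_d$; $\lfloor\beta\rfloor$ is the largest integer strictly less than $\beta$. $\mathbb H_d(\beta,L,M)$ is the set of functions $f:[0,1]^d\to\mathbb R$ having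 on $[0,1]^d$ all partial derivatives of order $\lfloor\beta\rfloor$ and such that for all $x,z\in[0,1]^d$ $$\sum_{0\le|p|\le\lfloor\beta\rfloor}\sup_{x\in[0,1]^d}\left|\frac{\partial^{|p|}f(x)}{\partial x_1^{p_1}\cdots\partial x_d^{p_d}}\right|\le M,\qquad \left|f(x)-\sum_{0\le|p|\le\lfloor\beta\rfloor}\frac{\partial^{|p|}f(z)}{\partial z_1^{p_1}\cdots\partial z_d^{p_d}}\prod_{j=1}^d\frac{(x_j-z_j)^{p_j}}{p_j!}\right|\le L\sum_{j=1}^d|x_j-z_j|^\beta .$$ $\mathbb H_d(\beta,L,M,A)=\{g\in\mathbb H_d(\beta,L,M):\inf_{x\in[0,1]^d}g(x)\ge A\}$. Risk. $R_{n,q}(\tilde f,\mathbb H_d(\beta,L,M,A))=\sup_{f\in\mathbb H_d(\beta,L,M,A)}\mathbb E_f|\tilde f(y)-f(y)|^q$. *)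

(* Defs.v *)
From HB Require Import structures.
From mathcomp Require Import all_boot all_order all_algebra.
From mathcomp Require Import all_classical all_reals all_analysis.

Set Implicit Arguments.
Unset Strict Implicit.
Unset Printing Implicit Defensive.

Import Order.TTheory GRing.Theory Num.Theory.
Import numFieldNormedType.Exports.

Local Open Scope classical_set_scope.
Local Open Scope ring_scope.

(** * Hölder classes on the unit cube

    A function on [0,1]^d is represented by a total function on 'rV[R]_d of
    which only the values on [cube d] are ever used. *)

Definition cube (R : realType) (d : nat) : set 'rV[R]_d :=
  [set x | forall j, 0 <= x 0 j <= 1].

Arguments cube {R} d.

(** Increments keep the point inside the cube, so that partial derivatives on
    the boundary are one-sided. *)
Definition cube_incr (R : realType) (d : nat) (j : 'I_d) (x : 'rV[R]_d) :
    set_system R :=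
  within [set t | cube d (x + t *: delta_mx 0 j)] (0 : R)^'.

Definition diff_quot (R : realType) (d : nat) (g : 'rV[R]_d -> R) (j : 'I_d)
    (x : 'rV[R]_d) (t : R) : R :=
  t^-1 * (g (x + t *: delta_mx 0 j) - g x).

Definition pderivable (R : realType) (d : nat) (g : 'rV[R]_d -> R) (j : 'I_d)
    (x : 'rV[R]_d) : Prop :=
  cvg (diff_quot g j x @ cube_incr j x).

Definition pderiv (R : realType) (d : nat) (j : 'I_d) (g : 'rV[R]_d -> R)
    (x : 'rV[R]_d) : R :=
  lim (diff_quot g j x @ cube_incr j x).

(** [pderivs [:: j1; ...; jk] f] is d/dx_j1 (... (d/dx_jk f)). *)
Definition pderivs (R : realType) (d : nat) (w : seq 'I_d)
    (f : 'rV[R]_d -> R) : 'rV[R]_d -> R :=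
  foldr (@pderiv R d) f w.

(** All iterated partial derivatives up to order [k], taken in any order of the
    variables, exist everywhere on the cube. *)
Definition has_pderivs (R : realType) (d k : nat) (f : 'rV[R]_d -> R) : Prop :=
  forall (w : seq 'I_d) (j : 'I_d) (x : 'rV[R]_d),
    (size w < k)%N -> cube d x -> pderivable (pderivs w f) j x.

(** A multi-index p with |p| <= k has all its entries in {0, ..., k}. *)
Definition multi_index (d k : nat) : finType := {ffun 'I_d -> 'I_k.+1}.

Definition mdeg (d k : nat) (p : multi_index d k) : nat := (\sum_j p j)%N.

Definition mderiv (R : realType) (d k : nat) (p : multi_index d k)
    (f : 'rV[R]_d -> R) : 'rV[R]_d -> R :=
  pderivs (flatten [seq nseq (p j) j | j <- enum 'I_d]) f.

(** The largest integer strictly less than b, for b > 0: see [sfloorP]. *)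
Definition sfloor (R : realType) (b : R) : nat := `|Num.ceil b|%N.-1.

Lemma sfloorP (R : realType) (b : R) : 0 < b ->
  (sfloor b)%:R < b <= (sfloor b).+1%:R.
Proof.
move=> b0; rewrite /sfloor.
have c0 : 0 < Num.ceil b by rewrite ceil_gt0.
have /andP[lb ub] := ceil_itv b.
move: c0 lb ub; case: (Num.ceil b) => [[|n]|n] //= _.
by rewrite -natr1 intrB /= -[n.+1]addn1 PoszD intrD /= addrK => -> ->.
Qed.

Definition taylor (R : realType) (d k : nat) (f : 'rV[R]_d -> R)
    (z x : 'rV[R]_d) : R :=
  \sum_(p : multi_index d k | (mdeg p <= k)%N)
    mderiv p f z * \prod_j ((x 0 j - z 0 j) ^+ p j / (p j)`!%:R).

Definition holder (R : realType) (d : nat) (b L M : R) : set ('rV[R]_d -> R) :=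
  [set f | [/\ has_pderivs (sfloor b) f,
     (\sum_(p : multi_index d (sfloor b) | (mdeg p <= sfloor b)%N)
        ereal_sup [set `|mderiv p f x|%:E | x in cube d] <= M%:E)%E
   & forall x z, cube d x -> cube d z ->
       `|f x - taylor (sfloor b) f z x|
         <= L * \sum_j `|x 0 j - z 0 j| `^ b]].

Definition holder_ge (R : realType) (d : nat) (b L M A : R) :
    set ('rV[R]_d -> R) :=
  [set g | holder b L M g /\
           (A%:E <= ereal_inf [set (g x)%:E | x in cube d])%E].

Arguments holder {R} d b L M.
Arguments holder_ge {R} d b L M A.

(** * The statistical model *)

Lemma card_grid (d m : nat) : (m ^ d)%N = #|{: {ffun 'I_d -> 'I_m}}|.
Proof. by rewrite card_ffun !card_ord. Qed.

(** The n = m ^ d points of the grid {1/m, 2/m, ..., 1}^d. *)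
Definition design (R : realType) (d m : nat) (i : 'I_(m ^ d)) : 'rV[R]_d :=
  let k : {ffun 'I_d -> 'I_m} := enum_val (cast_ord (card_grid d m) i) in
  \row_j ((k j).+1%:R / m%:R).

Definition mutually_independent (R : realType) (disp : measure_display)
    (Omega : measurableType disp) (P : probability Omega R)
    (n : nat) (U : 'I_n -> {RV P >-> R}) : Prop :=
  forall B : 'I_n -> set R, (forall i, measurable (B i)) ->
    P (\bigcap_(i in [set: 'I_n]) (U i @^-1` B i)) =
    (\prod_(i < n) P (U i @^-1` B i))%E.

Definition uniform01 (R : realType) (disp : measure_display)
    (Omega : measurableType disp) (P : probability Omega R)
    (U : {RV P >-> R}) : Prop :=
  forall B : set R, measurable B ->
    distribution P U B = uniform_prob (@ltr01 R) B.

Definition obs (R : realType) (disp : measure_display)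
    (Omega : measurableType disp) (P : probability Omega R)
    (d m : nat) (U : 'I_(m ^ d) -> {RV P >-> R})
    (f : 'rV[R]_d -> R) (w : Omega) : (m ^ d).-tuple R :=
  [tuple f (design R i) * U i w | i < m ^ d].

(** The design being deterministic, an estimator is a measurable function of the
    responses Y_1, ..., Y_n only. *)
Definition estimator (R : realType) (n : nat) : set (n.-tuple R -> R) :=
  [set t | measurable_fun [set: n.-tuple R] t].

Definition risk (R : realType) (disp : measure_display)
    (Omega : measurableType disp) (P : probability Omega R)
    (d m : nat) (U : 'I_(m ^ d) -> {RV P >-> R}) (y : 'rV[R]_d)
    (q : R) (t : (m ^ d).-tuple R -> R) (H : set ('rV[R]_d -> R)) : \bar R :=
  ereal_sup [set ('E_P[fun w => (`|t (obs U f w) - f y| `^ q)%R])%E | f in H].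

Arguments estimator {R} n.

Definition rate (R : realType) (d n : nat) (b : R) : R :=
  n%:R `^ (- (b / (b + d%:R))).

(* Main.v *)
(** Let [b < b'] be the two smoothness indices. Compare the constant function
    [c], which belongs to the class of smoothness [b'], with the function
    obtained by digging at [y] a dip of width [h = K n^(-1/(b + d))] and depth
    [a = e h^b]; for [e] small it belongs to the class of smoothness [b]. The
    responses under the dip are the responses under [c] conditioned on an event
    of probability [rho = \prod_i f(X_i)/c], so expectations under [c] are at
    least [rho] times those under the dip, and [rho >= exp(-Q)] with [Q]
    depending on [K] but not on [n], because [n h^d a] does not depend on [n].
    Since the rate for [b'] is polynomially faster than the rate for [b],
    [rate(b')^-q rho >= rate(b)^-q] for large [n], hence the weighted risk is at
    least [rate(b)^-q (a / 2)^q = (e K^b / 2)^q], where [K] is arbitrary. *)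

Require Import Defs.
From HB Require Import structures.
From mathcomp Require Import all_boot all_order all_algebra.
From mathcomp Require Import all_classical all_reals all_analysis.
From mathcomp Require Import measurable_realfun.
From mathcomp Require Import ring lra.
Import Order.TTheory GRing.Theory Num.Theory.
Import numFieldNormedType.Exports.
Local Open Scope classical_set_scope.
Local Open Scope ring_scope.

(** * A bump on the line with bounded derivatives *)

Section Sigmoid.
Context {R : realType}.
Implicit Types (x u v : R) (p : {poly R}).

Definition sigmoid x : R := (1 + expR (- x))^-1.

Lemma sigmoid_gt0 x : 0 < sigmoid x.
Proof. by rewrite invr_gt0 addr_gt0 ?expR_gt0. Qed.

Lemma sigmoid_lt1 x : sigmoid x < 1.
Proof. by rewrite invf_lt1 ?addr_gt0 ?expR_gt0// ltrDl expR_gt0. Qed.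

Lemma is_derive_sigmoid x :
  is_derive x 1 sigmoid (sigmoid x * (1 - sigmoid x)).
Proof.
have nz : 1 + expR (- x) != 0 by rewrite gt_eqF// addr_gt0 ?expR_gt0.
have dexp : is_derive x 1 (fun t => 1 + expR (- t)) (- expR (- x)).
  apply: (@is_derive_eq _ _ _ (cst 1 + expR \o -%R)).
  by rewrite add0r mulrN1.
have -> : sigmoid x * (1 - sigmoid x) =
    - (1 + expR (- x)) ^- 2 *: - expR (- x).
  by rewrite /sigmoid /GRing.scale/=; field.
exact: (@is_deriveV _ (fun t => 1 + expR (- t)) _ _ _ nz dexp).
Qed.

(** The factor 4 makes the peak value, reached at 0, equal to 1. *)
Fixpoint bump_poly (i : nat) : {poly R} :=
  if i is i'.+1 then (bump_poly i')^`() * ('X - 'X^2) else 4%:P * ('X - 'X^2).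

(** The sigmoid [s] satisfies [s' = s (1 - s)], so every derivative of
    [4 s (1 - s)] is a polynomial in [s], hence bounded. *)
Definition bump (i : nat) x : R := (bump_poly i).[sigmoid x].

Lemma is_derive_bump i x : is_derive x 1 (bump i) (bump i.+1 x).
Proof.
have := is_derive_sigmoid x => ds.
have dp := is_derive_poly (bump_poly i) (sigmoid x).
have -> : bump i.+1 x =
    ((bump_poly i)^`()).[sigmoid x] * (sigmoid x * (1 - sigmoid x)).
  by rewrite /bump/= hornerM hornerD hornerN hornerX hornerXn; ring.
exact: is_derive1_comp dp ds.
Qed.

Lemma horner_bounded01 p : exists C, forall x, 0 <= x <= 1 -> `|p.[x]| <= C.
Proof.
exists (\sum_(i < size p) `|p`_i|) => x /andP[x0 x1].
rewrite horner_coef (le_trans (ler_norm_sum _ _ _))//.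
apply: ler_sum => i _; rewrite normrM ler_piMr//.
by rewrite normrX (ger0_norm x0) exprn_ile1.
Qed.

Lemma bump_bounded (k : nat) :
  exists2 C, 1 <= C & forall i x, (i <= k)%N -> `|bump i x| <= C.
Proof.
elim: k => [|k [C C1 ih]].
  have [C hC] := horner_bounded01 (bump_poly 0).
  exists (Num.max C 1); first by rewrite le_max lexx orbT.
  move=> i x; rewrite leqn0 => /eqP ->; rewrite le_max hC//.
  by rewrite !ltW ?sigmoid_gt0 ?sigmoid_lt1.
have [D hD] := horner_bounded01 (bump_poly k.+1).
exists (Num.max C D); first by rewrite le_max C1.
move=> i x; rewrite leq_eqVlt => /predU1P[->|ik]; rewrite le_max; last first.
  by rewrite ih.
by rewrite hD ?orbT// !ltW ?sigmoid_gt0 ?sigmoid_lt1.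
Qed.

Lemma bump0E x : bump 0 x = 4 * (sigmoid x * (1 - sigmoid x)).
Proof. by rewrite /bump/= hornerCM hornerD hornerN hornerX hornerXn; ring. Qed.

Lemma bump0_ge0 x : 0 <= bump 0 x.
Proof.
by rewrite bump0E !mulr_ge0// ?subr_ge0 ltW ?sigmoid_gt0 ?sigmoid_lt1.
Qed.

Lemma bump0_le1 x : bump 0 x <= 1.
Proof.
rewrite bump0E -subr_ge0.
rewrite [X in 0 <= X](_ : _ = (1 - 2 * sigmoid x) ^+ 2); last by ring.
exact: sqr_ge0.
Qed.

Lemma bump00 : bump 0 0 = 1.
Proof. by rewrite bump0E /sigmoid oppr0 expR0; field. Qed.

(** With [E = exp u] and [e = exp t], the increment [s (u + t) - s u] is
    [s u (1 - s u) (e - 1) (1 + E) / (1 + E e)], and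
    [(e - 1) (1 + E) / (1 + E e) >= (e - 1) / e >= t / e]. *)
Lemma bump0_le_increment u t : 0 < t <= 1 ->
  bump 0 u <= 4 * expR 1 / t * (sigmoid (u + t) - sigmoid u).
Proof.
move=> /andP[t0 t1].
have e1 : 1 + t <= expR t := expR_ge1Dx t.
have ee : expR t <= expR 1 by rewrite ler_expR.
rewrite bump0E /sigmoid opprD expRD expRN [expR (- t)]expRN.
set E := expR u; set e := expR t in e1 ee *.
have E0 : 0 < E := expR_gt0 u.
have e0 : 0 < e := expR_gt0 t.
set c := expR 1 in ee *.
have EE : 0 < 1 + E by lra.
have Ee : 0 < 1 + E * e by rewrite addr_gt0// mulr_gt0.
have -> : (1 + E^-1 / e)^-1 - (1 + E^-1)^-1 =
    E * (e - 1) / ((1 + E * e) * (1 + E)).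
  field; rewrite !gt_eqF//=; nra.
have -> : (1 + E^-1)^-1 * (1 - (1 + E^-1)^-1) = E / (1 + E) ^+ 2.
  by field; rewrite !gt_eqF//=; lra.
rewrite -!mulrA ler_pM2l// ler_pdivrMr ?exprn_gt0//.
have -> : c * (t^-1 * (E * ((e - 1) / ((1 + E * e) * (1 + E))))) * (1 + E) ^+ 2
   = (E * (c * (e - 1) * (1 + E))) / (t * (1 + E * e)).
  by field; rewrite !gt_eqF.
rewrite ler_pdivlMr ?mulr_gt0// ler_pM2l//.
have h1 : t * (1 + E * e) <= t * (c * (1 + E)).
  by rewrite ler_pM2l//; nra.
apply: (le_trans h1).
have h2 : 0 < c * (1 + E) by rewrite mulr_gt0// (lt_le_trans e0).
rewrite -subr_ge0.
rewrite [X in 0 <= X](_ : _ = (e - 1 - t) * (c * (1 + E))); last by ring.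
by rewrite mulr_ge0 ?(ltW h2)//; lra.
Qed.

(** The bump is not compactly supported, so every grid point of the axis contributes. After
    rescaling the points are [t = (m h)^-1 <= 1] apart; each term is at most a constant over [t]
    times a sigmoid increment, and the increments telescope to less than 1. *)
Lemma sum_bump0_le (m : nat) (h z : R) : 0 < h -> 1 <= m%:R * h ->
  \sum_(i < m) bump 0 ((i.+1%:R / m%:R - z) / h) <= 4 * expR 1 * (m%:R * h).
Proof.
move=> h0 mh.
have m0 : 0 < (m%:R : R) by rewrite -(pmulr_lgt0 _ h0) (lt_le_trans _ mh).
pose t := (m%:R * h)^-1.
have t0 : 0 < t by rewrite invr_gt0 mulr_gt0.
have t1 : 0 < t <= 1 by rewrite t0 invf_le1// mulr_gt0.
pose u i := (i.+1%:R / m%:R - z) / h.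
have uS i : u i + t = u i.+1.
  by rewrite /u /t -[i.+2]addn1 natrD; field; rewrite !gt_eqF.
have tE : 4 * expR 1 * (m%:R * h) = 4 * expR 1 / t by rewrite /t invrK.
apply: (@le_trans _ _ (\sum_(i < m)
    4 * expR 1 / t * (sigmoid (u i.+1) - sigmoid (u i)))).
  by apply: ler_sum => i _; rewrite -uS bump0_le_increment.
rewrite -mulr_sumr tE ler_piMr ?divr_ge0 ?mulr_ge0 ?expR_ge0// ?ltW//.
rewrite -(big_mkord xpredT (fun i => sigmoid (u i.+1) - sigmoid (u i))).
rewrite telescope_sumr//.
by have := sigmoid_gt0 (u 0%N); have := sigmoid_lt1 (u m); lra.
Qed.

End Sigmoid.

(** * Partial derivatives on the cube *)

Section CubeDerivatives.
Context {R : realType} {d : nat}.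
Implicit Types (f F : 'rV[R]_d -> R) (x y z : 'rV[R]_d) (j : 'I_d) (w : seq 'I_d).

(** Properness makes limits along [cube_incr] unique. From any point of the cube one can move along
    axis [j], towards the farther face, by up to 1/2. *)
Lemma cube_incr_proper j x : cube d x -> ProperFilter (cube_incr j x).
Proof.
move=> xc; apply: (@Build_ProperFilter_ex _ (cube_incr j x)) => //.
move=> S /= [e e0 /= eS].
pose t := if x 0 j <= 2^-1 then Num.min (e / 2) 2^-1 else - Num.min (e / 2) 2^-1.
have m0 : 0 < Num.min (e / 2) 2^-1 by rewrite lt_min divr_gt0//= invr_gt0.
have m2 : Num.min (e / 2) 2^-1 <= 2^-1 :> R by rewrite ge_min lexx orbT.
have me : Num.min (e / 2) 2^-1 <= e / 2 by rewrite ge_min lexx.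
have t_abs : `|t| = Num.min (e / 2) 2^-1.
  by rewrite /t; case: ifP; rewrite ?normrN gtr0_norm.
exists t; apply: eS => /=.
- by rewrite sub0r normrN t_abs; move: e0 => /=; lra.
- by rewrite -normr_gt0 t_abs.
- move=> i; rewrite !mxE eqxx /=.
  have [->|ij] := eqVneq i j; last by rewrite mulr0 addr0.
  rewrite mulr1 /t; have := xc j.
  by case: ifPn; [|rewrite -ltNge] => ? /andP[? ?]; apply/andP; split; lra.
Qed.

(** Agreement on the cube suffices, so [f] may be an iterated [pderiv], whose values outside are
    uncontrolled, and [F] a closed formula differentiable across the boundary. *)
Lemma diff_quot_cvg f F j x l : {in cube d, f =1 F} -> cube d x ->
  is_derive (0 : R) 1 (fun t => F (x + t *: delta_mx 0 j)) l ->
  diff_quot f j x @ cube_incr j x --> l.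
Proof.
move=> fF xc [dF <-].
have fFx : f x = F x by apply: fF; rewrite inE.
apply: (@cvg_trans _ ((fun t : R => t^-1 *: (F (x + (t *: 1 + 0) *: delta_mx 0 j) -
    F (x + (0 : R) *: delta_mx 0 j))) @ cube_incr j x)).
  apply: near_eq_cvg; apply: (filterS _ (withinT _ _)) => /= t tc.
  rewrite /diff_quot fFx fF ?inE// scale0r addr0 addr0.
  by rewrite -[t *: 1]/(t * 1) mulr1.
apply: cvg_trans dF.
exact/cvg_app/cvg_within.
Qed.

End CubeDerivatives.

(** * The dip and its partial derivatives *)

Section Dip.
Context {R : realType} {d : nat}.
Variables (c a h : R) (y : 'rV[R]_d).
Implicit Types (x z : 'rV[R]_d) (j : 'I_d) (w : seq 'I_d) (p : 'I_d -> nat).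

Definition bump_prod p x := \prod_j bump (p j) ((x 0 j - y 0 j) / h).

Definition dip x := c - a * bump_prod (fun=> 0%N) x.

(** Closed form of the partial derivative of [dip] with multi-index [p]; the constant [c] survives
    at order zero only. *)
Definition dip_deriv p x :=
  (\sum_j p j == 0)%N%:R * c - a / h ^+ (\sum_j p j) * bump_prod p x.

Lemma dipE x : dip x = dip_deriv (fun=> 0%N) x.
Proof. by rewrite /dip_deriv big1// eqxx mul1r expr0 divr1. Qed.

Lemma eq_dip_deriv p1 p2 x : p1 =1 p2 -> dip_deriv p1 x = dip_deriv p2 x.
Proof. by move=> /funext ->. Qed.

Lemma is_derive_dip_deriv p j x :
  is_derive (0 : R) 1 (fun t => dip_deriv p (x + t *: delta_mx 0 j))
    (dip_deriv (fun i => (p i + (i == j))%N) x).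
Proof.
set N := (\sum_i p i)%N.
have NS : (\sum_i (p i + (i == j)) = N.+1)%N.
  rewrite big_split/= -/N (bigD1 j)//= eqxx big1 ?addn1// => i.
  by move=> /negbTE ->.
pose K := a / h ^+ N *
  \prod_(i | i != j) bump (p i) ((x 0 i - y 0 i) / h).
pose g t := bump (p j) ((x 0 j + t - y 0 j) / h).
have -> : (fun t => dip_deriv p (x + t *: delta_mx 0 j)) =
    cst ((N == 0)%N%:R * c) - K *: g.
  apply/funext => t; rewrite /dip_deriv -/N /bump_prod (bigD1 j)//=.
  rewrite !fctE /K /g /GRing.scale/= !mxE !eqxx/= mulr1.
  rewrite -!mulrA [X in _ - _ * (_ * X)]mulrC.
  congr (_ - _ * (_ * (_ * _))); apply: eq_bigr => i /negbTE ij.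
  by rewrite !mxE ij eqxx/= mulr0 addr0.
have dg : is_derive (0 : R) 1 g (bump (p j).+1 ((x 0 j - y 0 j) / h) * h^-1).
  pose l t := (x 0 j + t - y 0 j) / h.
  have dl : is_derive (0 : R) 1 l h^-1.
    have -> : l = h^-1 *: (cst (x 0 j) + id - cst (y 0 j)).
      by apply/funext => t; rewrite /l !fctE /GRing.scale/= mulrC.
    apply: is_derive_eq.
    by rewrite add0r subr0 /GRing.scale/= mulr1.
  have -> : (x 0 j - y 0 j) / h = l 0 by rewrite /l addr0.
  exact: is_derive1_comp (is_derive_bump (p j) (l 0)) dl.
have dK := is_deriveB (is_derive_cst ((N == 0)%N%:R * c) (0 : R) 1)
  (is_deriveZ K dg).
apply: is_derive_eq.
rewrite /dip_deriv NS/= mul0r !sub0r; congr (- _).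
rewrite /bump_prod (bigD1 j)//= eqxx addn1 exprSr /GRing.scale/=.
under eq_bigr => i /negbTE ij do rewrite ij addn0.
by rewrite /K invfM; ring.
Qed.

Lemma pderivs_dip w x : cube d x ->
  pderivs w dip x = dip_deriv (fun j => count_mem j w) x.
Proof.
elim: w x => [|j w ih] x xc; first exact: dipE.
have ? := cube_incr_proper j x xc.
apply/cvg_lim => //.
rewrite (@eq_dip_deriv _ (fun i => count_mem i w + (i == j))%N).
  apply: (diff_quot_cvg _ _ _ _ _ _ xc (is_derive_dip_deriv _ j x)) => z.
  by rewrite inE => /ih.
by move=> i /=; rewrite addnC eq_sym.
Qed.

Lemma has_pderivs_dip k : has_pderivs k dip.
Proof.
move=> w j x _ xc; apply: cvgP.
apply: (diff_quot_cvg _ _ _ _ _ _ xc (is_derive_dip_deriv (fun i => count_mem i w) j x)).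
by move=> z; rewrite inE => /(pderivs_dip w).
Qed.

Lemma mderiv_dip k (p : multi_index d k) x : cube d x ->
  mderiv p dip x = dip_deriv (fun j => p j) x.
Proof.
move=> xc; rewrite /mderiv pderivs_dip//; apply: eq_dip_deriv => j.
rewrite count_flatten -map_comp sumnE big_map big_enum/= (bigD1 j)//=.
rewrite count_nseq /= eqxx mul1n big1 ?addn0// => i ij.
by rewrite count_nseq /= (negbTE ij).
Qed.

End Dip.

(** * Taylor remainder in one variable *)

Section TaylorBound.
Context {R : realType}.

Lemma MVT_between (g dg : R -> R) (u v : R) :
  (forall x : R, is_derive x 1 g (dg x)) ->
  exists2 x, `|x - v| <= `|u - v| & g u - g v = dg x * (u - v).
Proof.
move=> gdg.
have gc : continuous g.
  by move=> x; apply/differentiable_continuous/derivable1_diffP; case: (gdg x).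
have [uv|/ltW vu] := leP u v.
  have [x xuv gE] := MVT_segment uv (fun x _ => gdg x)
    (continuous_subspaceT gc).
  move: xuv; rewrite in_itv/= => /andP[ux xv].
  exists x; last by rewrite -[LHS]opprB gE -mulrN opprB.
  by rewrite !ler0_norm ?subr_le0// lerN2 lerD2r.
have [x xuv gE] := MVT_segment vu (fun x _ => gdg x)
  (continuous_subspaceT gc).
move: xuv; rewrite in_itv/= => /andP[vx xu].
by exists x => //; rewrite !ger0_norm ?subr_ge0// lerD2r.
Qed.

(** Induction on [n], for all [i] at once: the derivative of the order [n.+1] remainder of [phi i]
    is the order [n] remainder of [phi i.+1]. The remainder vanishes at [v], so the mean value
    theorem gains one factor [|u - v|]. *)
Lemma taylor_bound (phi : nat -> R -> R) (C : R) (n i : nat) (u v : R) :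
  (forall i (x : R), is_derive x 1 (phi i) (phi i.+1 x)) ->
  (forall x, `|phi (i + n)%N x| <= C) ->
  `|phi i u - \sum_(l < n) phi (i + l)%N v * (u - v) ^+ l / l`!%:R|
    <= C * `|u - v| ^+ n.
Proof.
move=> dphi; elim: n i u v => [|n ih] i u v phiC.
  by have := phiC u; rewrite big_ord0 subr0 expr0 mulr1 addn0.
pose T m k : {poly R} := \poly_(l < m) (phi (k + l)%N v / l`!%:R).
have TE m k t : (T m k).[t - v] =
    \sum_(l < m) phi (k + l)%N v * (t - v) ^+ l / l`!%:R.
  by rewrite horner_poly; apply: eq_bigr => l _; rewrite mulrAC.
have dT : (T n.+1 i)^`() = T n i.+1.
  apply/polyP => l; rewrite coef_deriv !coef_poly ltnS.
  case: ifP => // _; last by rewrite mul0rn.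
  rewrite addSnnS factS natrM -mulrnAr invfM -[X in _ * X]mulr_natr mulrAC.
  by rewrite mulVf ?mul1r// pnatr_eq0.
pose g t := phi i t - (T n.+1 i).[t - v].
pose dg t := phi i.+1 t - (T n i.+1).[t - v].
have gdg (x : R) : is_derive x 1 g (dg x).
  have dl : is_derive x 1 (fun t => t - v) 1.
    apply: (@is_derive_eq _ _ _ (id - cst v)).
    by rewrite subr0.
  have dp := is_derive_poly (T n.+1 i) (x - v).
  have := is_deriveB (dphi i x) (@is_derive1_comp _ (horner (T n.+1 i)) (fun t => t - v) _ _ _ dp dl).
  by rewrite mulr1 dT.
have gv : g v = 0.
  rewrite /g TE subrr big_ord_recl/= addn0 expr0 mulr1 fact0 divr1.
  rewrite big1 ?addr0 ?subrr// => l _.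
  by rewrite expr0n/= mulr0 mul0r.
have [x xuv gE] := MVT_between _ _ u v gdg.
rewrite -TE -/(g u) -[g u]subr0 -[X in g u - X]gv gE normrM exprSr mulrA.
apply: ler_wpM2r => //.
rewrite /dg TE (le_trans (ih i.+1 x v _))//.
  by move=> t; rewrite addSnnS.
apply: ler_wpM2l; last exact: lerXn2r.
exact: le_trans (normr_ge0 _) (phiC 0).
Qed.

End TaylorBound.

(** * Truncating a product of Taylor polynomials *)

Section TruncatedProduct.
Context {R : realFieldType}.

Lemma norm_prod_le (I : Type) (s : seq I) (F : I -> R) (D : R) :
  (forall i, `|F i| <= D) -> `|\prod_(i <- s) F i| <= D ^+ size s.
Proof.
move=> FD; elim: s => [|i s ih]; first by rewrite big_nil normr1.
by rewrite big_cons normrM exprS ler_pM.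
Qed.

Lemma size_index_enum_ord (d : nat) : size (index_enum 'I_d) = d.
Proof. by rewrite -sum1_size big_const_ord iter_addn_0 mul1n. Qed.

Lemma norm_prod_ord_le (d : nat) (F : 'I_d -> R) (D : R) :
  (forall i, `|F i| <= D) -> `|\prod_i F i| <= D ^+ d.
Proof. by move=> FD; rewrite -[in leRHS](size_index_enum_ord d) norm_prod_le. Qed.

(** The factors are exchanged one at a time, each exchange costing a factor at most [e]; [1 <= D]
    allows [D ^+ size s] in place of one power less. *)
Lemma prod_sub_le (I : Type) (s : seq I) (F G : I -> R) (D e : R) : 1 <= D ->
  (forall i, `|F i| <= D) -> (forall i, `|G i| <= D) ->
  (forall i, `|F i - G i| <= e) ->
  `|\prod_(i <- s) F i - \prod_(i <- s) G i| <= (size s)%:R * D ^+ size s * e.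
Proof.
move=> D1 FD GD FG; elim: s => [|i s ih].
  by rewrite !big_nil subrr normr0 !mul0r.
have e0 : 0 <= e := le_trans (normr_ge0 _) (FG i).
have D0 : 0 <= D by rewrite (le_trans ler01).
rewrite !big_cons.
set f := \prod_(j <- s) F j in ih *; set g := \prod_(j <- s) G j in ih *.
rewrite (_ : _ - _ = F i * (f - g) + (F i - G i) * g); last by ring.
rewrite (le_trans (ler_normD _ _))// !normrM.
apply: (@le_trans _ _ (D * ((size s)%:R * D ^+ size s * e) + e * D ^+ size s)).
  by rewrite lerD// ler_pM// norm_prod_le.
rewrite /= -natr1 exprS.
rewrite -subr_ge0 (_ : _ - _ = (D - 1) * D ^+ size s * e); last by ring.
by rewrite !mulr_ge0 ?subr_ge0 ?exprn_ge0.
Qed.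

(** [t j] holds the Taylor terms of the factor [F j]; expanding the product of
    the Taylor polynomials produces the terms of total degree at most [k],
    which form the Taylor polynomial of the product, and higher order terms. *)
Lemma truncated_prod_bound (d k : nat) (C : R) : 1 <= C ->
  exists2 C', 0 < C' & forall (F : 'I_d -> R) (t : 'I_d -> 'I_k.+1 -> R) (e : R),
    0 <= e -> (forall j, `|F j| <= C) ->
    (forall j l, `|t j l| <= C * e ^+ l) ->
    (forall j, `|F j - \sum_l t j l| <= C * e ^+ k.+1) ->
    `|\prod_j F j -
      \sum_(p : multi_index d k | (mdeg p <= k)%N) \prod_j t j (p j)|
      <= C' * (if e <= 1 then e ^+ k.+1 else e ^+ k).
Proof.
move=> C1.
have C0 : 0 <= C by rewrite (le_trans ler01).
pose D := k.+1%:R * C.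
pose N := #|{: multi_index d k}|%:R : R.
have CD : C <= D by rewrite ler_peMl// ler1n.
have D1 : 1 <= D by rewrite (le_trans C1).
have D0 : 0 <= D by rewrite (le_trans ler01).
exists (d%:R * D ^+ d * C + (1 + N) * C ^+ d).
  rewrite ltr_wpDl ?mulr_ge0 ?exprn_ge0// mulr_gt0 ?exprn_gt0//.
    by rewrite ltr_pwDl.
  by rewrite (lt_le_trans ltr01).
move=> F t e e0 FC tC FtC.
have prod_t (p : multi_index d k) : `|\prod_j t j (p j)| <= C ^+ d * e ^+ mdeg p.
  rewrite normr_prod /mdeg expr_sum.
  apply: (@le_trans _ _ (\prod_j (C * e ^+ p j))).
    by apply: ler_prod => j _; rewrite normr_ge0 tC.
  by rewrite big_split/= prodr_const card_ord.
have FN : `|\prod_j F j| <= C ^+ d.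
  exact: norm_prod_ord_le.
(* For [e <= 1], the product is compared with the full product of Taylor sums, and the terms of
   degree above [k] are at most of order [e ^+ k.+1]. For [e >= 1], the product and the truncated
   sum are bounded separately by multiples of [e ^+ k]. *)
case: ifPn => [e1|]; last rewrite -ltNge => /ltW e1.
- pose S j := \sum_l t j l.
  have SD j : `|S j| <= D.
    rewrite (le_trans (ler_norm_sum _ _ _))//.
    apply: (@le_trans _ _ (\sum_(l < k.+1) C)).
      apply: ler_sum => l _; rewrite (le_trans (tC j l))// ler_piMr//.
      exact: exprn_ile1.
    by rewrite sumr_const card_ord /D mulr_natl.
  have SE : \prod_j S j = \sum_(p : multi_index d k) \prod_j t j (p j).
    by rewrite /S bigA_distr_bigA.
  have -> : \prod_j F j -
      \sum_(p : multi_index d k | (mdeg p <= k)%N) \prod_j t j (p j) =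
      (\prod_j F j - \prod_j S j) +
      \sum_(p : multi_index d k | ~~ (mdeg p <= k)%N) \prod_j t j (p j).
    rewrite SE [in RHS](bigID (fun p : multi_index d k => (mdeg p <= k)%N))/=.
    by ring.
  rewrite (le_trans (ler_normD _ _))// mulrDl lerD//.
    have := @prod_sub_le _ (index_enum 'I_d) F S D (C * e ^+ k.+1) D1.
    by rewrite size_index_enum_ord !mulrA; apply => // j; rewrite (le_trans (FC j)).
  rewrite (le_trans (ler_norm_sum _ _ _))//.
  apply: (@le_trans _ _ (\sum_(p : multi_index d k) C ^+ d * e ^+ k.+1)).
    rewrite [leRHS](bigID (fun p : multi_index d k => ~~ (mdeg p <= k)%N))/=.
    rewrite ler_wpDr ?sumr_ge0// => [p _|]; first by rewrite mulr_ge0 ?exprn_ge0.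
    apply: ler_sum => p; rewrite -ltnNge => kp.
    rewrite (le_trans (prod_t p))// ler_wpM2l ?exprn_ge0//.
    exact: ler_wiXn2l.
  rewrite sumr_const -[leLHS]mulr_natl -/N -mulrA.
  rewrite ler_wpM2r ?mulr_ge0 ?exprn_ge0//.
  by rewrite lerDr.
- rewrite (le_trans (ler_normB _ _))//.
  apply: (@le_trans _ _ ((1 + N) * C ^+ d * e ^+ k)); last first.
    by rewrite ler_wpM2r ?exprn_ge0// lerDr !mulr_ge0 ?exprn_ge0.
  rewrite mulrDl mul1r mulrDl lerD//.
    by rewrite (le_trans FN)// ler_peMr ?exprn_ge0 ?exprn_ege1.
  rewrite (le_trans (ler_norm_sum _ _ _))//.
  apply: (@le_trans _ _ (\sum_(p : multi_index d k) C ^+ d * e ^+ k)).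
    rewrite [leRHS](bigID (fun p : multi_index d k => (mdeg p <= k)%N))/=.
    rewrite ler_wpDr ?sumr_ge0// => [p _|]; first by rewrite mulr_ge0 ?exprn_ge0.
    apply: ler_sum => p pk.
    rewrite (le_trans (prod_t p))// ler_wpM2l ?exprn_ge0//.
    exact: ler_weXn2l.
  by rewrite sumr_const -[leLHS]mulr_natl -/N -mulrA.
Qed.

End TruncatedProduct.

(** * Taylor remainder of the dip *)

Section DipHolder.
Context {R : realType} {d : nat}.
Implicit Types (c a h b : R) (x y z : 'rV[R]_d).

(** The Hoelder condition measures increments by a sum of [b]-th powers; its [b]-th root dominates
    each coordinate and so provides the single scale [e] of [truncated_prod_bound]. *)
Lemma norm_le_powR_sum b x j : 0 < b ->
  `|x 0 j| <= (\sum_i `|x 0 i| `^ b) `^ b^-1.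
Proof.
move=> b0.
have {1}-> : `|x 0 j| = (`|x 0 j| `^ b) `^ b^-1.
  by rewrite -powRrM divff ?gt_eqF// powRr1.
apply: ge0_ler_powR.
- by rewrite invr_ge0 ltW.
- by rewrite nnegrE powR_ge0.
- by rewrite nnegrE sumr_ge0// => i _; exact: powR_ge0.
by rewrite (bigD1 j)//= lerDl sumr_ge0// => i _; exact: powR_ge0.
Qed.

(** Each power of [h^-1] is attached to an increment, leaving products of one-variable Taylor terms,
    the shape handled by [truncated_prod_bound]. *)
Lemma taylor_dip (k : nat) c a h y x z : cube d z ->
  taylor k (dip c a h y) z x =
  c - a * \sum_(p : multi_index d k | (mdeg p <= k)%N)
    \prod_j (bump (p j) ((z 0 j - y 0 j) / h) * ((x 0 j - z 0 j) / h) ^+ p j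
             / (p j)`!%:R).
Proof.
move=> zc; rewrite /taylor mulr_sumr.
pose mono (p : multi_index d k) :=
  \prod_j ((x 0 j - z 0 j) ^+ p j / (p j)`!%:R).
transitivity (\sum_(p : multi_index d k | (mdeg p <= k)%N)
    ((mdeg p == 0)%N%:R * c * mono p -
     a * \prod_j (bump (p j) ((z 0 j - y 0 j) / h) *
       ((x 0 j - z 0 j) / h) ^+ p j / (p j)`!%:R))).
  apply: eq_bigr => p _; rewrite mderiv_dip// /dip_deriv mulrBl.
  congr (_ - _); rewrite -!mulrA; congr (_ * _).
  rewrite /bump_prod -exprVn expr_sum -!big_split/=.
  apply: eq_bigr => j _; rewrite expr_div_n exprVn.
  by rewrite -!mulrA mulrCA; congr (_ * _); rewrite mulrCA.
rewrite big_split/= sumrN; congr (_ + _).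
pose p0 : multi_index d k := [ffun=> ord0].
have m0 : mdeg p0 = 0%N by rewrite /mdeg big1// => j _; rewrite ffunE.
rewrite (bigD1 p0) ?m0//= mul1r /mono big1 ?mulr1 => [|j _]; last first.
  by rewrite ffunE expr0 fact0 divr1.
rewrite big1 ?addr0// => p /andP[_ pp0].
suff /negbTE -> : mdeg p != 0%N by rewrite !mul0r.
apply: contraNN pp0; rewrite /mdeg sum_nat_eq0. move=> /forallP p00.
apply/eqP/ffunP => j; rewrite ffunE; apply/val_inj/eqP => /=.
by have := p00 j; rewrite implyTb.
Qed.

(** With [s] the sum in the Hoelder condition and [e = s^(1/b) / h], the product estimate gives
    [e^(k+1)] if [e <= 1] and [e^k] otherwise. As [k < b <= k + 1], both are at most
    [e^b = s / h^b]. *)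
Lemma dip_taylor_bound b : 0 < b ->
  exists2 C, 0 < C & forall c a h y x z, 0 < h -> 0 <= a ->
    cube d z ->
    `|dip c a h y x - taylor (sfloor b) (dip c a h y) z x|
      <= a * C / h `^ b * \sum_j `|x 0 j - z 0 j| `^ b.
Proof.
move=> b0; set k := sfloor b.
have /andP[kb bk] := sfloorP b0.
have [B B1 hB] := @bump_bounded R k.+1.
have [C C0 hC] := truncated_prod_bound d k B B1.
exists C => // c a h y x z h0 a0 zc.
pose s := \sum_j `|x 0 j - z 0 j| `^ b.
have s0 : 0 <= s by rewrite sumr_ge0// => i _; exact: powR_ge0.
pose e := s `^ b^-1 / h.
have e0 : 0 <= e by rewrite divr_ge0 ?powR_ge0 ?ltW.
have eb : e `^ b = s / h `^ b.
  rewrite /e powRM ?powR_ge0 ?invr_ge0 ?(ltW h0)// -powRrM mulVf ?gt_eqF//.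
  by rewrite powRr1// -(powR_inv1 (ltW h0)) powRAC powR_inv1 ?powR_ge0.
have de j : `|(x 0 j - z 0 j) / h| <= e.
  rewrite normrM normfV (gtr0_norm h0) ler_pM2r ?invr_gt0//.
  have := norm_le_powR_sum b (x - z) j b0; rewrite !mxE => /le_trans; apply.
  by under eq_bigr do rewrite !mxE.
pose F j := bump 0 ((x 0 j - y 0 j) / h).
pose t j (l : 'I_k.+1) := bump l ((z 0 j - y 0 j) / h) *
  ((x 0 j - z 0 j) / h) ^+ l / l`!%:R.
have tB j l : `|t j l| <= B * e ^+ l.
  rewrite /t !normrM -mulrA ler_pM//.
    by rewrite hB// ltnW// ltn_ord.
  rewrite -[leRHS]mulr1 ler_pM//.
    by rewrite normrX lerXn2r// ?nnegrE.
  by rewrite normfV normr_nat invf_le1 ?ltr0n ?fact_gt0// ler1n fact_gt0.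
have FtB j : `|F j - \sum_l t j l| <= B * e ^+ k.+1.
  have := taylor_bound (@bump R) B k.+1 0 ((x 0 j - y 0 j) / h)
    ((z 0 j - y 0 j) / h) is_derive_bump.
  rewrite -mulrBl opprB addrA subrK add0n => /(_ (fun v => hB _ v (leqnn _))).
  move=> /le_trans; apply.
  by rewrite ler_wpM2l ?(le_trans ler01)// lerXn2r// nnegrE.
have := hC F t e e0 (fun j => hB 0%N _ isT) tB FtB.
rewrite taylor_dip// /dip -/s => HC.
set sumt := \sum_(p | _) _.
rewrite (_ : _ - _ = - a * (bump_prod h y (fun=> 0%N) x - sumt)); last first.
  by rewrite /sumt; ring.
rewrite normrM normrN (ger0_norm a0) -!mulrA ler_wpM2l//.
rewrite (le_trans HC)// ler_pM2l// mulrC -eb.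
have [e1|/ltW e1] := leP e 1.
  rewrite -powR_mulrn//; have [->|en0] := eqVneq e 0.
    by rewrite !powR0 ?gt_eqF// ltr0Sn.
  by rewrite ger_powR// lt_neqAle eq_sym en0 e0.
by rewrite -powR_mulrn// ler_powR// ltW.
Qed.
End DipHolder.

(** * Dips in the Hoelder classes *)

Section DipHolderClass.
Context {R : realType} {d : nat}.
Implicit Types (c a h b : R) (x y z : 'rV[R]_d).

Lemma bump_prod0_ge0 h y x : 0 <= bump_prod h y (fun=> 0%N) x.
Proof. by rewrite prodr_ge0// => j _; exact: bump0_ge0. Qed.

Lemma bump_prod0_le1 h y x : bump_prod h y (fun=> 0%N) x <= 1.
Proof. by rewrite prodr_ile1// => j _; rewrite bump0_ge0 bump0_le1. Qed.

Lemma dip_bounds c a h y x : 0 <= a -> c - a <= dip c a h y x <= c.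
Proof.
move=> a0; rewrite lerD2l lerN2 gerDl oppr_le0 mulr_ge0 ?bump_prod0_ge0//.
by rewrite andbT ler_piMr// bump_prod0_le1.
Qed.

Lemma norm_dip_deriv_le (k : nat) (B : R) c a h y (p : multi_index d k) x :
  1 <= B -> (forall i u, (i <= k)%N -> `|bump i u| <= B) ->
  (mdeg p <= k)%N -> 0 < h <= 1 -> 0 <= a <= c ->
  `|dip_deriv c a h y (fun j => p j) x|
    <= (mdeg p == 0)%N%:R * c + a / h ^+ k * B ^+ d.
Proof.
move=> B1 hB pk /andP[h0 h1] /andP[a0 ac].
have B0 : 0 <= B by rewrite (le_trans ler01).
have c0 := le_trans a0 ac.
have [p0|p0] := eqVneq (mdeg p) 0%N.
  rewrite mul1r.
  rewrite (eq_dip_deriv c a h y _ (fun=> 0%N)) => [|j]; last first.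
    by move/eqP: p0; rewrite sum_nat_eq0 => /forall_inP/(_ j isT)/eqP.
  rewrite -dipE.
  have /andP[l u] := dip_bounds c a h y x a0.
  rewrite ger0_norm ?(le_trans _ l) ?subr_ge0//.
  by rewrite (le_trans u)// lerDl mulr_ge0 ?divr_ge0 ?exprn_ge0// ltW.
rewrite /dip_deriv -/(mdeg p) (negbTE p0) mul0r sub0r add0r normrN normrM.
rewrite ger0_norm; last by rewrite divr_ge0 ?exprn_ge0// ltW.
rewrite ler_pM ?divr_ge0 ?exprn_ge0 ?(ltW h0)//.
  by rewrite ler_wpM2l// lef_pV2 ?posrE ?exprn_gt0// ler_wiXn2l// ltW.
rewrite /bump_prod norm_prod_ord_le// => j.
by apply: hB; rewrite -ltnS ltn_ord.
Qed.

(** The size [h ^ b] of the dip is dictated by the Hoelder condition: rescaling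
    by [h] multiplies the [b]-Hoelder constant by [h ^ - b]. *)
Lemma dip_holder_ge b (L A M c : R) : 0 < b -> 0 < L -> 0 < A -> A < c < M ->
  exists2 eps, 0 < eps & forall h a y, 0 < h <= 1 -> 0 <= a <= eps * h `^ b ->
    holder_ge d b L M A (dip c a h y).
Proof.
move=> b0 L0 A0 /andP[Ac cM].
set k := sfloor b.
have /andP[kb bk] := sfloorP b0.
have [C C0 hC] := @dip_taylor_bound R d b b0.
have [B B1 hB] := @bump_bounded R k.
have B0 : 0 < B by rewrite (lt_le_trans ltr01).
pose N := #|{: multi_index d k}|%:R : R.
have N0 : 0 <= N by [].
(* [e1] secures the Hoelder constant [L], [e2] the lower bound [A], and [e3] the bound [M]: besides
   [c], the sum of suprema is at most [N] terms [a / h ^+ k * B ^+ d]. *)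
pose e1 := L / C; pose e2 := c - A; pose e3 := (M - c) / ((1 + N) * B ^+ d).
have NB : 0 < (1 + N) * B ^+ d by rewrite mulr_gt0 ?exprn_gt0 ?ltr_pwDl.
have e10 : 0 < e1 by rewrite divr_gt0.
have e20 : 0 < e2 by rewrite subr_gt0.
have e30 : 0 < e3 by rewrite divr_gt0 ?subr_gt0.
exists (Num.min e1 (Num.min e2 e3)).
  by rewrite !lt_min e10 e20 e30.
move=> h a y /andP[h0 h1] /andP[a0 ae].
have hb0 : 0 < h `^ b := powR_gt0 _ h0.
have ae1 : a <= e1 * h `^ b.
  by rewrite (le_trans ae)// ler_pM2r// ge_min lexx.
have ae2 : a <= e2.
  rewrite (le_trans ae)// -[leRHS]mulr1 ler_pM ?powR_ge0//.
  - by rewrite !le_min !ltW.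
  - by rewrite !ge_min lexx orbT.
  - by rewrite -(powRr0 h) ger_powR ?h0// ltW.
have ae3 : a / h ^+ k <= e3.
  rewrite ler_pdivrMr ?exprn_gt0// (le_trans ae)// ler_pM ?powR_ge0//.
  - by rewrite !le_min !ltW.
  - by rewrite !ge_min lexx !orbT.
  - by rewrite -(powR_mulrn k (ltW h0)) ger_powR ?h0// ltW.
have ac : a <= c by rewrite (le_trans ae2)// gerBl ltW.
split; last first.
  apply: le_ereal_inf_tmp => _ [x _ <-]; rewrite lee_fin.
  have /andP[l _] := dip_bounds c a h y x a0.
  by apply: le_trans l; move: ae2; rewrite /e2; lra.
split.
- exact: has_pderivs_dip.
- apply: (@le_trans _ _ (\sum_(p : multi_index d k | (mdeg p <= k)%N)
     ((mdeg p == 0)%N%:R * c + a / h ^+ k * B ^+ d)%:E)%E).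
    apply: lee_sum => p pk; apply: ge_ereal_sup => _ [x xc <-].
    by rewrite lee_fin mderiv_dip// norm_dip_deriv_le// ?h0// a0.
  rewrite sumEFin lee_fin big_split/=.
  have -> : M = c + (1 + N) * (e3 * B ^+ d).
    by rewrite /e3; field; rewrite !gt_eqF ?exprn_gt0 ?ltr_pwDl.
  apply: lerD.
    pose p0 : multi_index d k := [ffun=> ord0].
    have m0 : mdeg p0 = 0%N by rewrite /mdeg big1// => j _; rewrite ffunE.
    rewrite (bigD1 p0) ?m0//= mul1r big1 ?addr0// => p /andP[_ pp0].
    suff /negbTE -> : mdeg p != 0%N by rewrite !mul0r.
    apply: contraNN pp0; rewrite /mdeg sum_nat_eq0 => /forall_inP p00.
    apply/eqP/ffunP => j; rewrite ffunE; apply/val_inj/eqP => /=.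
    exact: p00.
  have E0 : 0 <= a / h ^+ k * B ^+ d.
    by rewrite mulr_ge0 ?divr_ge0 ?exprn_ge0// ltW.
  apply: (@le_trans _ _ (\sum_(p : multi_index d k) a / h ^+ k * B ^+ d)).
    rewrite [leRHS](bigID (fun p : multi_index d k => (mdeg p <= k)%N))/=.
    by rewrite lerDl sumr_ge0.
  rewrite sumr_const -[leLHS]mulr_natl -/N ler_pM//.
    by rewrite lerDr.
  by rewrite ler_wpM2r ?exprn_ge0// ltW.
- move=> x z xc zc; rewrite (le_trans (hC c a h y x z h0 a0 zc))//.
  apply: ler_wpM2r; first by rewrite sumr_ge0// => j _; exact: powR_ge0.
  by rewrite ler_pdivrMr// -ler_pdivlMr// mulrAC.
Qed.

End DipHolderClass.

(** * Scaling a uniform variable *)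

Section ScaledUniform.
Context {R : realType}.

(** By uniqueness of Lebesgue measure: [r^-1] times its image under division by [r] gives half-open
    intervals their length. *)
Lemma lebesgue_measure_scale (r : R) (C : set R) : 0 < r -> measurable C ->
  lebesgue_measure ((fun x => x / r) @^-1` C) = (r%:E * lebesgue_measure C)%E.
Proof.
move=> r0 mC.
have mf : measurable_fun [set: measurableTypeR R]
    (fun x : R => (x / r) : measurableTypeR R).
  exact: mulrr_measurable.
have rV0 : 0 <= r^-1 by rewrite invr_ge0 ltW.
pose push : {measure set (measurableTypeR R) -> \bar R} :=
  measure_function_pushforward__canonical__measure_function_Measure
    (@lebesgue_measure R) mf.
rewrite (@lebesgue_measure_unique R (mscale (NngNum rV0) push) _ C mC).
  by rewrite /mscale/= /pushforward muleA -EFinM divff ?gt_eqF// mul1e.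
move=> _ [[a b] _ <-] /=; rewrite /mscale/= /pushforward.
rewrite [X in (_ * lebesgue_measure X)%E](_ : _ = `]a * r, b * r]%classic).
  rewrite !lebesgue_measure_itv/= !lte_fin ltr_pM2r//.
  case: ifPn => ab; last by rewrite mule0.
  by rewrite -!EFinD -EFinM; congr EFin; field; rewrite gt_eqF.
by apply/seteqP; split => x /=; rewrite !in_itv/= ltr_pdivlMr// ler_pdivrMr.
Qed.

Lemma uniform_prob01E (C : set R) : measurable C ->
  uniform_prob (@ltr01 R) C = lebesgue_measure (C `&` `[0, 1]).
Proof.
move=> mC; rewrite /uniform_prob integral_uniform_pdf.
rewrite (eq_integral (cst 1%E)); last first.
  move=> x; rewrite inE/= in_itv/= => -[_ x01].
  by rewrite /uniform_pdf x01 subr0 invr1.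
by rewrite integral_cst ?mul1e//; exact: measurableI.
Qed.

(** One coordinate of the change of measure: [X <= r] has probability [r] and, given this event,
    [X / r] is again uniform. *)
Lemma uniform01_scale (disp : measure_display) (Omega : measurableType disp)
    (P : probability Omega R) (X : {RV P >-> R}) (r : R) (C : set R) :
  uniform01 X -> 0 < r <= 1 -> measurable C ->
  P (X @^-1` [set x | x / r <= 1 /\ C (x / r)]) = (r%:E * P (X @^-1` C))%E.
Proof.
move=> XU /andP[r0 r1] mC.
have mf : measurable_fun [set: R] (fun x : R => x / r) by exact: mulrr_measurable.
have mD : measurable (C `&` `]-oo, (1 : R)]) by exact: measurableI.
have DE : [set x | x / r <= 1 /\ C (x / r)] =
    (fun x => x / r) @^-1` (C `&` `]-oo, (1 : R)]).
  by apply/seteqP; split => x /=; rewrite in_itv/= => -[].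
rewrite DE.
have mE : measurable ((fun x => x / r) @^-1` (C `&` `]-oo, (1 : R)])).
  by rewrite -[X in measurable X]setTI; exact: mf.
have := XU _ mC; rewrite /distribution /pushforward => ->.
have := XU _ mE; rewrite /distribution /pushforward => ->.
rewrite !uniform_prob01E// -lebesgue_measure_scale//; last exact: measurableI.
congr (lebesgue_measure _); apply/seteqP; split => x /=; rewrite !in_itv/=.
  by move=> [[Cx x1] /andP[x0 _]]; rewrite divr_ge0// ltW.
move=> [Cx /andP[x0 x1]]; rewrite x1; split => //; move: x0 x1.
rewrite pmulr_lge0 ?invr_gt0// => ->; rewrite ler_pdivrMr// mul1r => xr.
by rewrite (le_trans xr).
Qed.

End ScaledUniform.

(** * Finite measures on tuples *)

Section TupleMeasure.
Context {R : realType} {disp : measure_display} {T : measurableType disp}.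
Variable n : nat.

Definition box (B : 'I_n -> set T) : set (n.-tuple T) :=
  [set t | forall i, B i (tnth t i)].

Lemma boxE B : box B = \bigcap_(i in [set: 'I_n]) ((@tnth n T)^~ i @^-1` B i).
Proof. by apply/seteqP; split => t /= tB i *; exact: tB. Qed.

Lemma measurable_box B : (forall i, measurable (B i)) -> measurable (box B).
Proof.
move=> mB; rewrite boxE; apply: fin_bigcap_measurable => // i _.
rewrite -[X in measurable X]setTI; exact: measurable_tnth.
Qed.

(** Boxes are stable under intersection and generate the sigma-algebra of tuples. *)
Lemma tuple_measure_unique (m1 m2 : {measure set (n.-tuple T) -> \bar R}) :
  (m1 [set: n.-tuple T] < +oo)%E ->
  (forall B, (forall i, measurable (B i)) -> m1 (box B) = m2 (box B)) ->
  forall E, measurable E -> m1 E = m2 E.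
Proof.
move=> m1oo m12 E mE.
pose G := [set X : set (n.-tuple T) |
  exists2 B, (forall i, measurable (B i)) & X = box B].
have GT : G setT.
  by exists (fun=> setT) => //; apply/seteqP; split.
apply: (@g_sigma_algebra_measure_unique _ R _ G _ (fun=> setT)) => //.
- by move=> _ [B mB ->]; exact: measurable_box.
- by rewrite bigcup_const//; exists 0%N.
- move=> _ _ [B mB ->] [C mC ->]; exists (fun i => B i `&` C i).
    by move=> i; exact: measurableI.
  apply/seteqP; split => t /=; first by move=> [tB tC] i.
  by move=> tBC; split => i; have [] := tBC i.
- by move=> _ [B mB ->]; exact: m12.
- move: E mE; apply: smallest_sub; first exact: smallest_sigma_algebra.
  move=> X; rewrite -bigcup_seq => -[i _ [C mC <-]].
  apply: sub_sigma_algebra.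
  exists (fun j => if j == i then C else setT).
    by move=> j; case: ifP.
  rewrite setTI; apply/seteqP; split => t /=.
    by move=> Ct j; case: eqP => [->|].
  by move/(_ i); rewrite eqxx.
Qed.

End TupleMeasure.

(** * Change of measure for the observations *)

Section ChangeOfMeasure.
Context {R : realType} {disp : measure_display} {Omega : measurableType disp}.
Variables (P : probability Omega R) (n : nat) (U : 'I_n -> {RV P >-> R}).
Hypothesis U_indep : mutually_independent U.
Hypothesis U_unif : forall i, uniform01 (U i).

Lemma measurable_tuple_scale (c : 'I_n -> R) :
  measurable_fun [set: Omega] (fun w => [tuple c i * U i w | i < n]).
Proof.
apply/measurable_fun_tnthP => i.
rewrite (_ : _ \o _ = fun w => c i * U i w); last first.
  by apply/funext => w /=; rewrite tnth_mktuple.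
exact: (@measurable_funM _ _ _ setT (cst (c i)) (U i)).
Qed.

Lemma probability_box (V : 'I_n -> set R) : (forall i, measurable (V i)) ->
  P [set w | forall i, V i (U i w)] = (\prod_(i < n) P (U i @^-1` V i))%E.
Proof.
move=> mV; rewrite -U_indep//; congr (P _).
by apply/seteqP; split => w /= wV i *; exact: wV.
Qed.

(** Given [U i <= r i] for all [i], which has probability [\prod_i r i], the
    rescaled variables [U i / r i] are again independent and uniform. *)
Lemma expectation_scale_le (c r : 'I_n -> R) (g : n.-tuple R -> R) :
  (forall i, 0 < r i <= 1) -> measurable_fun [set: n.-tuple R] g ->
  (forall t, 0 <= g t) ->
  ((\prod_i r i)%:E * 'E_P[fun w => (g [tuple r i * c i * U i w | i < n])%R]
    <= 'E_P[fun w => (g [tuple c i * U i w | i < n])%R])%E.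
Proof.
move=> r01 mg g0.
have r0 i : 0 < r i by case/andP: (r01 i).
have rho0 : 0 <= \prod_i r i by rewrite prodr_ge0// => i _; exact: ltW.
pose V w := [tuple 1 * U i w | i < n].
pose W w := [tuple (r i)^-1 * U i w | i < n].
have mV : measurable_fun [set: Omega] V := measurable_tuple_scale _.
have mW : measurable_fun [set: Omega] W := measurable_tuple_scale _.
pose VP : {measure set (n.-tuple R) -> \bar R} :=
  measure_function_pushforward__canonical__measure_function_Measure P mV.
pose WP : {measure set (n.-tuple R) -> \bar R} :=
  measure_function_pushforward__canonical__measure_function_Measure P mW.
pose D := box n (fun=> `]-oo, (1 : R)]%classic).
have mD : measurable D by exact: measurable_box.
(* The law of the rescaled variables [W], restricted to [D], is [\prod_i r i] times the law of the
   original ones; boxes reduce this to one coordinate. *)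
have VWP E : measurable E -> mrestr WP mD E = mscale (NngNum rho0) VP E.
  apply: tuple_measure_unique => [|B mB].
    rewrite /= /mrestr setTI/= /pushforward.
    rewrite (le_lt_trans (probability_le1 _ _)) ?ltry//.
    by rewrite -[X in measurable X]setTI; apply: (mW measurableT).
  rewrite /= /mscale/= /mrestr/= /pushforward.
  have -> : W @^-1` (box n B `&` D) =
      [set w | forall i, [set x | x / r i <= 1 /\ B i (x / r i)] (U i w)].
    apply/seteqP; split => w /=.
      move=> [wB wD] i; have := wB i; have := wD i.
      by rewrite /W tnth_mktuple/= in_itv/= mulrC.
    move=> wBD; split => i; have [wD wB] := wBD i;
      by rewrite /W tnth_mktuple /= ?in_itv/= mulrC.
  have -> : V @^-1` box n B = [set w | forall i, B i (U i w)].
    by apply/seteqP; split => w /= wB i; have := wB i;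
      rewrite /V tnth_mktuple mul1r.
  rewrite (probability_box B)//.
  rewrite (probability_box (fun i => [set x | x / r i <= 1 /\ B i (x / r i)]));
      last first.
    move=> i; rewrite (_ : [set x | _] =
        (fun x => x / r i) @^-1` (B i `&` `]-oo, (1 : R)])).
      rewrite -[X in measurable X]setTI.
      have mdiv : measurable_fun [set: R] (fun x : R => x / r i).
        exact: mulrr_measurable.
      by apply: mdiv => //; exact: measurableI.
    by apply/seteqP; split => x /=; rewrite in_itv/= => -[].
  rewrite -prodEFin -big_split/=; apply: eq_bigr => i _.
  exact: uniform01_scale.
(* At [V] this is [g] of the data with factors [r i * c i]; at [W] the [r i] cancel. *)
pose G t := g [tuple (r i * c i) * tnth t i | i < n].
have mG : measurable_fun [set: n.-tuple R] (EFin \o G).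
  apply/measurable_EFinP; apply: (measurableT_comp mg).
  apply/measurable_fun_tnthP => i.
  rewrite (_ : _ \o _ = fun t => (r i * c i) * tnth t i); last first.
    by apply/funext => t /=; rewrite tnth_mktuple.
  exact: (@measurable_funM _ _ _ setT (cst (r i * c i)) (@tnth n R ^~ i)
    (measurable_cst _) (measurable_tnth i)).
have G0 t : (0 <= (EFin \o G) t)%E by rewrite lee_fin g0.
have DN : mscale (NngNum rho0) VP (~` D) = 0%E.
  by rewrite -VWP; [rewrite /mrestr setICl measure0|exact: measurableC].
have GV : ('E_P[fun w => (g [tuple r i * c i * U i w | i < n])%R] =
    \int[VP]_(t in setT) (EFin \o G) t)%E.
  rewrite unlock ge0_integral_pushforward// preimage_setT.
  apply: eq_integral => w _; congr (g _)%:E.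
  by apply: eq_from_tnth => i; rewrite !tnth_mktuple mul1r.
have GW : ('E_P[fun w => (g [tuple c i * U i w | i < n])%R] =
    \int[WP]_(t in setT) (EFin \o G) t)%E.
  rewrite unlock ge0_integral_pushforward// preimage_setT.
  apply: eq_integral => w _; congr (g _)%:E.
  apply: eq_from_tnth => i; rewrite !tnth_mktuple.
  by field; rewrite gt_eqF.
rewrite GV GW.
have <- := @ge0_integral_mscale _ _ _ VP setT measurableT (NngNum rho0)
  (EFin \o G) mG (fun t _ => G0 t).
(* The law of [V] does not charge the complement of [D], and on [D] its multiple is the law of [W].
   Dropping the rest of the latter gives the inequality. *)
rewrite (@ge0_negligible_integral _ _ _ (mscale (NngNum rho0) VP) setT (~` D))//;
  last exact: measurableC.
rewrite setDE setCK setTI (@eq_measure_integral _ _ _ D WP); last first.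
  move=> E mE ED; transitivity (mrestr WP mD E); first exact/esym/VWP.
  by rewrite /mrestr setIidl.
exact: ge0_subset_integral.
Qed.

End ChangeOfMeasure.

(** * Two-point lower bound *)

Section TwoPoint.
Context {R : realType} {d : nat}.
Implicit Types (c a h : R) (x y : 'rV[R]_d).

(** From [exp(2 x) >= 1 + 2 x] and [(1 + 2 x) (1 - x) >= 1]. It bounds a product of likelihood
    factors by the exponential of a sum. *)
Lemma expR_N2_le (x : R) : 0 <= x <= 2^-1 -> expR (- (2 * x)) <= 1 - x.
Proof.
move=> /andP[x0 x2].
have e1 : 1 + 2 * x <= expR (2 * x) := expR_ge1Dx _.
have p1 : 0 < 1 + 2 * x by lra.
rewrite expRN (@le_trans _ _ (1 + 2 * x)^-1)// ?lef_pV2 ?posrE ?expR_gt0//.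
by rewrite -[leLHS]mul1r ler_pdivrMr//; nra.
Qed.

(** On the full grid the sum of products is the product over the axes of one-dimensional sums. *)
Lemma sum_bump_prod_design_le (m : nat) h y : 0 < h -> 1 <= m%:R * h ->
  \sum_(i < m ^ d) bump_prod h y (fun=> 0%N) (design R i)
    <= (4 * expR 1 * (m%:R * h)) ^+ d.
Proof.
move=> h0 mh.
pose u (j : 'I_d) (l : 'I_m) : R := bump 0 ((l.+1%:R / m%:R - y 0 j) / h).
have -> : \sum_(i < m ^ d) bump_prod h y (fun=> 0%N) (design R i) =
    \prod_j \sum_l u j l.
  rewrite bigA_distr_bigA/=.
  rewrite (reindex (fun i : 'I_(m ^ d) => enum_val (cast_ord (card_grid d m) i))).
    apply: eq_bigr => i _; apply: eq_bigr => j _.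
    by rewrite /u /design mxE.
  apply: onW_bij; apply: bij_comp; first exact: enum_val_bij.
  exact: (Bijective (cast_ordK _) (cast_ordKV _)).
apply: (@le_trans _ _ (\prod_(j < d) (4 * expR 1 * (m%:R * h)))).
  apply: ler_prod => j _; rewrite sumr_ge0 => [|l _]; last exact: bump0_ge0.
  exact: sum_bump0_le.
by rewrite prodr_const card_ord.
Qed.

Lemma prod_dip_design_ge (m : nat) c a h y : 0 < c -> 0 <= a <= c / 2 ->
  0 < h -> 1 <= m%:R * h ->
  expR (- (2 * (a / c) * (4 * expR 1 * (m%:R * h)) ^+ d))
    <= \prod_(i < m ^ d) (dip c a h y (design R i) / c).
Proof.
move=> c0 /andP[a0 ac] h0 mh.
have ac0 : 0 <= a / c by rewrite divr_ge0// ltW.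
pose x (i : 'I_(m ^ d)) := a / c * bump_prod h y (fun=> 0%N) (design R i).
apply: (@le_trans _ _ (expR (\sum_(i < m ^ d) - (2 * x i)))).
  rewrite ler_expR sumrN lerN2 /x -!mulr_sumr mulrA.
  by rewrite ler_wpM2l ?(mulr_ge0 _ ac0)// sum_bump_prod_design_le.
rewrite expR_sum; apply: ler_prod => i _; rewrite expR_ge0/=.
have -> : dip c a h y (design R i) / c = 1 - x i.
  by rewrite /dip /x; field; rewrite gt_eqF.
apply: expR_N2_le; rewrite mulr_ge0 ?bump_prod0_ge0//=.
rewrite (@le_trans _ _ (a / c))//.
  by rewrite ler_piMr// bump_prod0_le1.
by rewrite ler_pdivrMr// mulrC.
Qed.

(** A value [v] cannot be closer than [a / 2] to both [c] and [c - a]. *)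
Lemma half_dist_le_sum (q v c a : R) : 0 <= q -> 0 <= a ->
  (a / 2) `^ q <= `|v - c| `^ q + `|v - (c - a)| `^ q.
Proof.
move=> q0 a0.
have [va|/ltW va] := leP (a / 2) `|v - c|.
  rewrite (@le_trans _ _ (`|v - c| `^ q))// ?lerDl ?powR_ge0//.
  by rewrite ge0_ler_powR// nnegrE divr_ge0.
rewrite (@le_trans _ _ (`|v - (c - a)| `^ q))// ?lerDr ?powR_ge0//.
rewrite ge0_ler_powR// ?nnegrE ?divr_ge0//.
rewrite opprB addrCA -[v - c]opprK -/(_ - _).
have := lerB_dist a (- (v - c)); rewrite normrN opprK (ger0_norm a0); lra.
Qed.

(** The constant function is the dip of depth 0. The change of measure bounds its term below by an
    expectation under the dip; both terms then refer to one law, and [half_dist_le_sum] applies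
    pointwise. *)
Lemma two_point_bound (disp : measure_display) (Omega : measurableType disp)
    (P : probability Omega R) (m : nat) (U : 'I_(m ^ d) -> {RV P >-> R})
    (t : (m ^ d).-tuple R -> R) y c a h (q w0 w1 : R) :
  mutually_independent U -> (forall i, uniform01 (U i)) ->
  estimator (m ^ d) t -> 0 < c -> 0 <= a <= c / 2 -> 0 <= q ->
  0 <= w0 -> 0 <= w1 ->
  ((Num.min (w0 * \prod_(i < m ^ d) (dip c a h y (design R i) / c)) w1
      * (a / 2) `^ q)%:E
    <= w0%:E * 'E_P[fun w => (`|t (obs U (dip c 0 h y) w) - dip c 0 h y y| `^ q)%R]
     + w1%:E * 'E_P[fun w => (`|t (obs U (dip c a h y) w) - dip c a h y y| `^ q)%R])%E.
Proof.
move=> Uindep Uunif mt c0 /andP[a0 ac] q0 w00 w10.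
have dip0 x : dip c 0 h y x = c by rewrite /dip mul0r subr0.
have dipy : dip c a h y y = c - a.
  by rewrite /dip /bump_prod big1 ?mulr1// => j _; rewrite subrr mul0r bump00.
have dip_gt0 x : 0 < dip c a h y x.
  by have /andP[+ _] := dip_bounds c a h y x a0; apply: lt_le_trans; lra.
pose r (i : 'I_(m ^ d)) := dip c a h y (design R i) / c.
have r01 i : 0 < r i <= 1.
  rewrite divr_gt0//= ler_pdivrMr// mul1r.
  by have /andP[] := dip_bounds c a h y (design R i) a0.
set rho := \prod_(i < m ^ d) _.
have rho0 : 0 <= rho by rewrite prodr_ge0// => i _; case/andP: (r01 i) => /ltW.
pose g v (s : (m ^ d).-tuple R) := `|t s - v| `^ q.
have mg v : measurable_fun [set: (m ^ d).-tuple R] (g v).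
  apply: (@measurableT_comp _ _ _ _ _ _ (@powR R ^~ q)) => //.
  apply: measurableT_comp => //.
  exact: measurable_funB.
have mo : measurable_fun [set: Omega] (obs U (dip c a h y)).
  exact: measurable_tuple_scale.
have mgo v : measurable_fun [set: Omega] (fun w => (g v (obs U (dip c a h y) w))%:E).
  by apply/measurable_EFinP; exact: measurableT_comp.
have := expectation_scale_le P (m ^ d) U Uindep Uunif (fun=> c) r (g c) r01
  (mg c) (fun s => powR_ge0 _ _).
have -> : (fun w => g c [tuple r i * c * U i w | i < m ^ d]) =
    (fun w => g c (obs U (dip c a h y) w)).
  apply/funext => w; congr g; apply: eq_from_tnth => i.
  by rewrite !tnth_mktuple /r divfK// gt_eqF.
have -> : (fun w => g c [tuple c * U i w | i < m ^ d]) =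
    (fun w => `|t (obs U (dip c 0 h y) w) - dip c 0 h y y| `^ q).
  apply/funext => w; rewrite dip0; congr g; apply: eq_from_tnth => i.
  by rewrite !tnth_mktuple dip0.
rewrite -/rho dipy.
set E0 := ('E_P[fun w => (`|t (obs U (dip c 0 h y) w) - _| `^ q)%R])%E => E0ge.
pose G (v : R) : \bar R := ('E_P[fun w => (g v (obs U (dip c a h y) w))%R])%E.
rewrite -/(G (c - a)).
have G0 v : (0 <= G v)%E by apply: expectation_ge0 => w; exact: powR_ge0.
have GG : (((a / 2) `^ q)%:E <= G c + G (c - a)%R)%E.
  rewrite /G unlock -ge0_integralD//=; first last.
  - by move=> w _; rewrite lee_fin powR_ge0.
  - by move=> w _; rewrite lee_fin powR_ge0.
  have <- : (\int[P]_w ((a / 2) `^ q)%:E = ((a / 2) `^ q)%:E)%E.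
    rewrite integral_cst//=; have -> := @probability_setT _ _ _ P; exact: mule1.
  apply: ge0_le_integral => //.
  - by move=> w _; rewrite lee_fin powR_ge0.
  - by apply: emeasurable_funD.
  - by move=> w _; rewrite -EFinD lee_fin half_dist_le_sum.
set mu := Num.min _ _.
have mu0 : 0 <= mu by rewrite le_min mulr_ge0.
apply: (@le_trans _ _ (mu%:E * (G c + G (c - a)%R))%E).
  by rewrite EFinM lee_wpmul2l.
rewrite ge0_muleDr//; apply: leeD.
  apply: (@le_trans _ _ (w0%:E * (rho%:E * G c))%E); last by rewrite lee_wpmul2l.
  by rewrite muleA -EFinM lee_wpmul2r// lee_fin ge_min lexx.
by rewrite lee_wpmul2r// lee_fin ge_min lexx orbT.
Qed.

End TwoPoint.

(** * Choice of the dip and asymptotics *)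

Section Asymptotics.
Context {R : realType} {d : nat}.
Hypothesis d_gt0 : (0 < d)%N.

Lemma grid_size_powR_near (C p : R) : 0 < p ->
  \forall k \near \oo, C <= ((k.+1 ^ d)%N%:R : R) `^ p.
Proof.
move=> p0; near=> k.
pose D := Num.max C 0.
have D0 : 0 <= D by rewrite le_max lexx orbT.
apply: (@le_trans _ _ D); first by rewrite le_max lexx.
have -> : D = (D `^ p^-1) `^ p by rewrite -powRrM mulVf ?gt_eqF// powRr1.
apply: ge0_ler_powR; rewrite ?nnegrE ?powR_ge0//; first exact: ltW.
apply: (@le_trans _ _ k%:R); first by near: k; exact: nbhs_infty_ger.
by rewrite ler_nat (leq_trans (leqnSn k))// -{1}[k.+1]expn1 leq_pexp2l.
Unshelve. all: by end_near. Qed.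

(** The alternative is a dip of width [h = K n^(-1/(b + d))] and depth
    proportional to [h^b = K^b n^(-b/(b + d))]: it is [K^b] times larger than
    the rate for the smoothness [b], while its likelihood ratio with the constant
    function stays bounded below by a constant depending only on [K]. *)
Lemma dip_scaling (n m : nat) (b K : R) (h : R := K * n%:R `^ (- (b + d%:R)^-1)) :
  (0 < m)%N -> n = (m ^ d)%N -> 0 < b -> 1 <= K ->
  [/\ 0 < h, 1 <= m%:R * h, h `^ b = K `^ b * n%:R `^ (- (b / (b + d%:R))) &
    h `^ b * (m%:R * h) ^+ d = K `^ (b + d%:R)].
Proof.
move=> m0 nE b0 K1.
have d0 : 0 < (d%:R : R) by rewrite ltr0n.
have bd0 : 0 < b + d%:R by rewrite addr_gt0.
have K0 : 0 < K by rewrite (lt_le_trans ltr01).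
have n1 : 1 <= (n%:R : R) by rewrite nE ler1n expn_gt0 m0.
have n0 : 0 < (n%:R : R) by rewrite (lt_le_trans ltr01).
have h0 : 0 < h by rewrite mulr_gt0// powR_gt0.
split=> //.
(* As [1/d >= 1/(b + d)], the dip is at least as wide as the grid spacing. *)
- have -> : (m%:R : R) = n%:R `^ d%:R^-1.
    by rewrite nE natrX -powR_mulrn// -powRrM divff ?powRr1// gt_eqF.
  rewrite /h mulrCA -powRD; last by rewrite (gt_eqF n0) implybT.
  rewrite mulr_ege1// -[leLHS](powRr0 n%:R) ler_powR//.
  by rewrite subr_ge0 lef_pV2 ?posrE// lerDr ltW.
- rewrite /h powRM ?powR_ge0 ?ltW// -powRrM.
  by congr (_ * _ `^ _); rewrite mulNr mulrC.
- rewrite exprMn mulrCA -[h ^+ d]powR_mulrn ?ltW//.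
  rewrite -powRD; last by rewrite (gt_eqF h0) implybT.
  rewrite /h powRM ?powR_ge0 ?ltW// -powRrM mulNr mulVf ?gt_eqF//.
  rewrite powR_inv1 ?ltW// -natrX -nE mulrCA divff ?mulr1// gt_eqF//.
Qed.

(** The threshold on [k] precedes the estimator, so the bound passes to the infimum over
    estimators. *)
Lemma weighted_risk_ge_near (y : 'rV[R]_d)
    (disp : nat -> measure_display)
    (Omega : forall n : nat, measurableType (disp n))
    (P : forall n : nat, probability (Omega n) R)
    (U : forall n : nat, 'I_n -> {RV (P n) >-> R})
    (b b' L A M q T : R) :
  (forall n, mutually_independent (U n)) ->
  (forall (n : nat) (i : 'I_n), uniform01 (U n i)) ->
  0 < b -> b < b' -> 0 < L -> 0 < A -> A < M -> 1 <= q ->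
  \forall k \near \oo, forall t, estimator (k.+1 ^ d) t ->
    (T%:E <=
      (rate d (k.+1 ^ d) b' `^ (- q))%:E *
        risk (U (k.+1 ^ d)%N) y q t (holder_ge d b' L M A) +
      (rate d (k.+1 ^ d) b `^ (- q))%:E *
        risk (U (k.+1 ^ d)%N) y q t (holder_ge d b L M A))%E.
Proof.
move=> Uindep Uunif b0 bb' L0 A0 AM q1.
have b'0 : 0 < b' by rewrite (lt_trans b0).
have q0 : 0 < q by rewrite (lt_le_trans ltr01).
have d0 : 0 < (d%:R : R) by rewrite ltr0n.
pose c := (A + M) / 2.
have c0 : 0 < c by rewrite /c; lra.
have AcM : A < c < M by apply/andP; split; rewrite /c; lra.
have [e' e'0 He'] := @dip_holder_ge R d b' L A M c b'0 L0 A0 AcM.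
have [e1 e10 He1] := @dip_holder_ge R d b L A M c b0 L0 A0 AcM.
(* The cap [c / 2] keeps the depth [a] at most [c / 2], as the likelihood estimate requires. *)
pose e := Num.min e1 (c / 2).
have e0 : 0 < e by rewrite lt_min e10 divr_gt0.
pose T' := Num.max T 1.
have T'1 : 1 <= T' by rewrite le_max lexx orbT.
(* Chosen so that [e / 2 * K^b = e / 2 + T']; since [1 <= T'], the power [q >= 1] does not decrease
   a quantity that is at least [T']. *)
pose K := (1 + 2 * T' / e) `^ b^-1.
have T'e : 0 <= 2 * T' / e.
  by rewrite divr_ge0 ?mulr_ge0 ?(le_trans ler01 T'1)// ltW.
have K1 : 1 <= K.
  by rewrite -(powRr0 (1 + 2 * T' / e)) ler_powR ?lerDl// invr_ge0 ltW.
have Kb : K `^ b = 1 + 2 * T' / e.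
  by rewrite /K -powRrM mulVf ?gt_eqF// powRr1// addr_ge0.
have K0 : 0 < K by rewrite (lt_le_trans ltr01).
(* The exponent of [prod_dip_design_ge] for [a = e h^b], with [h^b (m h)^d] replaced by its value
   [K^(b + d)], free of [n]. *)
pose Q := 2 * (e / c) * (4 * expR 1) ^+ d * K `^ (b + d%:R).
pose gam (s : R) := s / (s + d%:R).
have gam_lt : 0 < (gam b' - gam b) * q.
  rewrite mulr_gt0// subr_gt0 /gam ltr_pdivrMr ?addr_gt0// mulrAC.
  by rewrite ltr_pdivlMr ?addr_gt0// !mulrDr mulrC ltrD2l ltr_pM2r.
near=> k.
set m := k.+1; set n := (m ^ d)%N => t mt.
pose N : R := n%:R.
have N1 : 1 <= N by rewrite ler1n expn_gt0.
have N0 : 0 < N by rewrite (lt_le_trans ltr01).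
pose h := K * N `^ (- (b + d%:R)^-1).
have [h0 mh hb hbd] := @dip_scaling n m b K isT erefl b0 K1.
rewrite -/N -/h in h0 mh hb hbd.
have h1 : h <= 1.
  rewrite /h powRN ler_pdivrMr ?powR_gt0// mul1r.
  rewrite /N /n /m; near: k; apply: grid_size_powR_near.
  by rewrite invr_gt0 addr_gt0.
have NQ : expR Q <= N `^ ((gam b' - gam b) * q).
  by rewrite /N /n /m; near: k; exact: grid_size_powR_near.
pose a := e * h `^ b.
have hb1 : h `^ b <= 1 by rewrite -(powRr0 h) ger_powR ?h0// ltW.
have a0 : 0 <= a by rewrite mulr_ge0 ?powR_ge0 ?ltW.
have ac : a <= c / 2.
  rewrite /a -[leRHS]mulr1 ler_pM ?powR_ge0 ?(ltW e0)//.
  by rewrite ge_min lexx orbT.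
have ae1 : a <= e1 * h `^ b.
  by rewrite ler_wpM2r ?powR_ge0// ge_min lexx.
have rateE s : rate d n s `^ (- q) = N `^ (gam s * q).
  by rewrite /rate -powRrM mulrNN.
rewrite !rateE.
have f'_in : holder_ge d b' L M A (dip c 0 h y).
  by apply: He'; rewrite ?h0 ?h1// lexx mulr_ge0 ?powR_ge0 ?ltW.
have f_in : holder_ge d b L M A (dip c a h y).
  by apply: He1; rewrite ?h0 ?h1// a0.
set rho := \prod_(i < n) (dip c a h y (design R i) / c).
have rho_ge : expR (- Q) <= rho.
  apply: le_trans (prod_dip_design_ge m c a h y c0 _ h0 mh); last by rewrite a0.
  rewrite ler_expR lerN2 /Q -hbd /a exprMn.
  by rewrite le_eqVlt; apply/orP; left; apply/eqP; ring.
(* The polynomial gap between the rates outweighs [expR Q], so the minimum in [two_point_bound] is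
   the weight for [b]. *)
have w_ge : N `^ (gam b * q) <= N `^ (gam b' * q) * rho.
  apply: (@le_trans _ _ (N `^ (gam b' * q) * expR (- Q))); last first.
    by rewrite ler_wpM2l ?powR_ge0.
  rewrite expRN ler_pdivlMr ?expR_gt0//.
  have -> : gam b' * q = gam b * q + (gam b' - gam b) * q by ring.
  rewrite powRD; last by rewrite (gt_eqF N0) implybT.
  by rewrite ler_wpM2l ?powR_ge0.
have T_le : T <= N `^ (gam b * q) * (a / 2) `^ q.
  rewrite powRrM -powRM ?powR_ge0 ?divr_ge0//.
  have -> : N `^ gam b * (a / 2) = e / 2 * K `^ b.
    rewrite /a hb powRN -/(gam b); field.
    by rewrite gt_eqF ?powR_gt0.
  apply: (@le_trans _ _ T'); first by rewrite le_max lexx.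
  have T'K : T' <= e / 2 * K `^ b.
    rewrite Kb (_ : _ * _ = e / 2 + T'); last by field; rewrite gt_eqF.
    by rewrite lerDr divr_ge0 ?ltW.
  by rewrite (le_trans T'K)// le1r_powR// (le_trans T'1).
apply: (@le_trans _ _
  (Num.min (N `^ (gam b' * q) * rho) (N `^ (gam b * q)) * (a / 2) `^ q)%:E).
  by rewrite lee_fin min_r.
apply: le_trans (@two_point_bound R d _ _ (P n) m (U n) t y c a h q
  (N `^ (gam b' * q)) (N `^ (gam b * q)) (Uindep n) (Uunif n) mt c0 _ _ _ _) _.
- by rewrite a0.
- exact: ltW.
- exact: powR_ge0.
- exact: powR_ge0.
apply: leeD; apply: lee_wpmul2l; rewrite ?lee_fin ?powR_ge0//.
- by apply: ereal_sup_ubound; exists (dip c 0 h y).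
- by apply: ereal_sup_ubound; exists (dip c a h y).
Unshelve. all: by end_near. Qed.

End Asymptotics.

(* The limit is along n = m ^ d with m >= 1, each n having its own probability
   space. *)
Theorem theorem3p1 (R : realType) (d : nat) (d_gt0 : (0 < d)%N)
    (y : 'rV[R]_d) (y_cube : cube d y)
    (disp : nat -> measure_display)
    (Omega : forall n : nat, measurableType (disp n))
    (P : forall n : nat, probability (Omega n) R)
    (U : forall n : nat, 'I_n -> {RV (P n) >-> R})
    (U_indep : forall n : nat, mutually_independent (U n))
    (U_unif : forall (n : nat) (i : 'I_n), uniform01 (U n i))
    (B : set R) (B_pos : B `<=` [set b | 0 < b]) (B_card : (`I_2 #<= B)%card)
    (b1 b2 : R) (b1B : B b1) (b2B : B b2) (b12 : b1 <> b2)
    (L A M q : R) (L_gt0 : 0 < L) (A_gt0 : 0 < A) (AM : A < M) (q_ge1 : 1 <= q) :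
  limn_einf (fun k : nat =>
    let m := k.+1 in
    let n := (m ^ d)%N in
    ereal_inf [set
      ((rate d n b1 `^ (- q))%:E * risk (U n) y q t (holder_ge d b1 L M A)
       + (rate d n b2 `^ (- q))%:E * risk (U n) y q t (holder_ge d b2 L M A))%E
      | t in estimator n]) = +oo%E.
Proof.
apply: (cvg_limn_einf_sup _).1; apply/cvgeyPge => T.
have b1_gt0 := B_pos _ b1B; have b2_gt0 := B_pos _ b2B.
(* The dip is taken in the class of the smaller index, whichever of the two it is. *)
have [b21|b12'|] := ltgtP b2 b1; last by move=> b2E; case: b12.
- have H := weighted_risk_ge_near d_gt0 y disp Omega P U b2 b1 L A M q T
    U_indep U_unif b2_gt0 b21 L_gt0 A_gt0 AM q_ge1.
  near=> k; apply: le_ereal_inf_tmp => _ [t mt <-].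
  by move: t mt; near: k; exact: H.
- have H := weighted_risk_ge_near d_gt0 y disp Omega P U b1 b2 L A M q T
    U_indep U_unif b1_gt0 b12' L_gt0 A_gt0 AM q_ge1.
  near=> k; apply: le_ereal_inf_tmp => _ [t mt <-]; rewrite addeC.
  by move: t mt; near: k; exact: H.
Unshelve. all: by end_near. Qed.
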